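(* Let $\alpha,\beta$ be real numbers such that, for all integers $n\ge 0$, $n+\alpha+\beta+2\neq 0$ and the numbers $$a_n=-\frac{\alpha+\tfrac12+(-1)^{n+1}\left(\beta+\tfrac12\right)}{n+\alpha+\beta+2}$$ satisfy $-1<a_n<1$. Let $\Phi_n(z)$ be the monic orthogonal polynomials on the unit circle with Verblunsky parameters $a_n$ (the Jacobi OPUC), and let $\psi_n(z)$, $n\ge 0$, be the corresponding CMV Laurent polynomials. Let $\mathcal K$ be the operator on Laurent polynomials in $z$ given by $$\mathcal K = z\,\partial_z+\frac{z\left((\alpha+\beta+1)z+\alpha-\beta\right)}{1-z^2}\,(R-\mathcal I),$$ where $(Rf)(z)=f(1/z)$ and $\mathcal I$ is the identity operator. Then for every $n=0,1,2,\dots$ $$\mathcal K\psi_n(z)=\lambda_n\psi_n(z),\qquad \lambda_n=\begin{cases}-\dfrac n2, & n\ \text{even},\\[2mm] \dfrac{n+1}{2}+\alpha+\beta+1, & n\ \text{odd}.\end{cases}$$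
   Context: Given real Verblunsky parameters $a_n$, $n\ge0$, the monic polynomials $\Phi_n(z)$ of degree $n$ are determined by $\Phi_0(z)=1$ and the Szegő recurrence $$\Phi_{n+1}(z)=z\Phi_n(z)-a_n\Phi_n^*(z),\qquad \Phi_n^*(z)=z^n\Phi_n(1/z),\quad n\ge 0.$$ The associated CMV Laurent polynomials are $$\psi_{2n}(z)=z^n\Phi_{2n}(1/z),\qquad \psi_{2n+1}(z)=z^{-n}\Phi_{2n+1}(z),\qquad n=0,1,2,\dots$$ For a Laurent polynomial $f$, the difference $f(1/z)-f(z)$ is divisible by $1-z^2$ in the ring of Laurent polynomials, so $\mathcal K$ maps Laurent polynomials to Laurent polynomials. *)

(* Defs.v *)
From HB Require Import structures.
From mathcomp Require Import all_boot all_order all_algebra.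
From mathcomp Require Import boolp.
From mathcomp Require Import ring.
Set Implicit Arguments.
Unset Strict Implicit.
Unset Printing Implicit Defensive.
Import Order.TTheory GRing.Theory Num.Theory.
Local Open Scope ring_scope.
Local Open Scope quotient_scope.

(* The Laurent polynomials in z over F are realised as the subring of the
   field F(z) of rational functions formed by the quotients p(z) / z ^ n. *)
Notation ratfun F := {fraction {poly F}}.

Section FieldIdentities.
Variable K : fieldType.
Implicit Types a b c d u v x y z : K.

Fact subf_div x y a b : x != 0 -> y != 0 ->
  a / x - b / y = (a * y - b * x) / (x * y).
Proof. by move=> x0 y0; field; rewrite x0 y0. Qed.

Fact divdiff_le c d u y : d != 0 -> u != 0 -> y != 0 ->
  (c * y^-1 * (u * y) - c * y / (u * y)) / d = c * ((u - u^-1) / d).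
Proof. by move=> d0 u0 y0; field; rewrite d0 u0 y0. Qed.

Fact divdiff_ge c d u y : d != 0 -> u != 0 -> y != 0 ->
  (c * (u * y)^-1 * y - c * (u * y) / y) / d = - c * ((u - u^-1) / d).
Proof. by move=> d0 u0 y0; field; rewrite d0 u0 y0. Qed.

Fact divdiff_geom z m : z != 0 -> 1 - z ^+ 2 != 0 ->
  (z ^+ m - (z ^+ m)^-1) / (1 - z ^+ 2)
  = - (\sum_(i < m) z ^+ 2 ^+ i) / z ^+ m.
Proof.
move=> z0 d0; apply/eqP; rewrite eqr_div ?expf_neq0 //; apply/eqP.
have := subrX1 (z ^+ 2) m; rewrite -exprM mulnC exprM => e.
rewrite -[1 - z ^+ 2]opprB mulNr mulrN opprK mulrC [RHS]mulrC -e.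
by rewrite mulrC mulrBl mulVf ?expf_neq0 // expr2.
Qed.

End FieldIdentities.

Section RationalFunctions.
Variable F : fieldType.
Implicit Types (p q : {poly F}) (f g : ratfun F) (c : F).

Definition pfrac : {poly F} -> ratfun F := @FracField.tofrac {poly F}.
HB.instance Definition _ := GRing.RMorphism.on pfrac.

Definition rf_const : F -> ratfun F := pfrac \o polyC.
HB.instance Definition _ := GRing.RMorphism.on rf_const.

Definition rf_z : ratfun F := pfrac 'X.

Definition poly_at_zinv p : ratfun F := (map_poly rf_const p).[rf_z^-1].

(* f(1/z), computed on a fraction representing f (see rf_reflE) *)
Definition rf_refl f : ratfun F :=
  poly_at_zinv \n_(repr f) / poly_at_zinv \d_(repr f).

(* df/dz, by the quotient rule on a fraction representing f (see rf_derivE) *)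
Definition rf_deriv f : ratfun F :=
  let p := \n_(repr f) in let q := \d_(repr f) in
  pfrac (p^`() * q - p * q^`()) / pfrac q ^+ 2.

Definition rf_K (alpha beta : F) f : ratfun F :=
  rf_z * rf_deriv f
  + rf_z * (rf_const (alpha + beta + 1) * rf_z + rf_const (alpha - beta))
      / (1 - rf_z ^+ 2) * (rf_refl f - f).

Lemma pfrac_inj : injective pfrac.
Proof. by move=> p q /eqP; rewrite /pfrac tofrac_eq => /eqP. Qed.

Lemma pfrac_eq0 p : (pfrac p == 0) = (p == 0).
Proof. exact: tofrac_eq0. Qed.

Lemma rf_z_neq0 : rf_z != 0.
Proof. by rewrite pfrac_eq0 polyX_eq0. Qed.

Lemma rf_repr f :
  f = pfrac \n_(repr f) / pfrac \d_(repr f) /\ \d_(repr f) != 0.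
Proof.
split; last exact: denom_ratioP.
have dn0 := denom_ratioP (repr f).
apply: (mulIf (x := pfrac \d_(repr f))); first by rewrite pfrac_eq0.
rewrite divfK ?pfrac_eq0 // /pfrac; move: dn0.
rewrite -{2}[f]reprK; move: (repr f) => x dn0; unlock FracField.tofrac.
rewrite -[LHS]FracField.pi_mul; apply/eqmodP.
rewrite /= /FracField.equivf /FracField.mulf !numden_Ratio ?mulr1 ?oner_eq0 //.
by rewrite mulrC.
Qed.

Lemma pfrac_div_eq p q p' q' : q != 0 -> q' != 0 ->
  pfrac p / pfrac q = pfrac p' / pfrac q' -> p * q' = p' * q.
Proof.
move=> q0 q'0 /eqP; rewrite eqr_div ?pfrac_eq0 // -!rmorphM.
by move=> /eqP /pfrac_inj.
Qed.

HB.instance Definition _ := GRing.RMorphism.copy poly_at_zinv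
  (horner_eval (rf_z^-1) \o map_poly rf_const).

Lemma poly_at_zinvXn n : poly_at_zinv 'X^n = (rf_z ^+ n)^-1.
Proof. by rewrite /poly_at_zinv map_polyXn hornerXn exprVn. Qed.

Lemma poly_at_zinvE p n : (size p <= n.+1)%N ->
  poly_at_zinv p = pfrac (\poly_(i < n.+1) p`_(n - i)) / rf_z ^+ n.
Proof.
move=> sp; apply: (mulIf (x := rf_z ^+ n)); rewrite ?expf_neq0 ?rf_z_neq0 //.
rewrite divfK ?expf_neq0 ?rf_z_neq0 //.
rewrite /poly_at_zinv (horner_coef_wide _ (n := n.+1)); last first.
  by rewrite size_map_poly.
rewrite poly_def rmorph_sum mulr_suml (reindex_inj rev_ord_inj) /=.
apply: eq_bigr => i _; rewrite coef_map -mul_polyC rmorphM rmorphXn -/rf_z subSS.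
rewrite -mulrA; congr (_ * _).
have -> : rf_z ^+ n = rf_z ^+ (n - i) * rf_z ^+ i by rewrite -exprD subnK // -ltnS.
by rewrite exprVn mulKf // expf_neq0 ?rf_z_neq0.
Qed.

Lemma poly_at_zinv_eq0 p : (poly_at_zinv p == 0) = (p == 0).
Proof.
apply/idP/idP => [|/eqP ->]; last by rewrite rmorph0.
rewrite (poly_at_zinvE (leqnSn _)) mulf_eq0 invr_eq0 expf_eq0.
rewrite (negbTE rf_z_neq0) andbF orbF pfrac_eq0 => /eqP e.
apply/eqP/polyP => i; rewrite coef0.
have [le|lt] := leqP i (size p); last by rewrite nth_default // ltnW.
have := congr1 (fun r : {poly F} => r`_(size p - i)) e.
by rewrite coef_poly coef0 ltnS leq_subr subKn.
Qed.

Lemma rf_reflE p q : q != 0 ->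
  rf_refl (pfrac p / pfrac q) = poly_at_zinv p / poly_at_zinv q.
Proof.
move=> q0; rewrite /rf_refl; set f := pfrac p / _.
have [ef d0] := rf_repr f.
apply/eqP; rewrite eqr_div ?poly_at_zinv_eq0 // -!rmorphM.
by rewrite (pfrac_div_eq d0 q0 (esym ef)).
Qed.

Lemma rf_derivE p q : q != 0 ->
  rf_deriv (pfrac p / pfrac q) = pfrac (p^`() * q - p * q^`()) / pfrac q ^+ 2.
Proof.
move=> q0; rewrite /rf_deriv /=; set f := pfrac p / _.
have [ef d0] := rf_repr f; move: d0 ef.
move: (\n_(repr f)) (\d_(repr f)) => u v v0 ef.
have e := pfrac_div_eq v0 q0 (esym ef).
have e' : u^`() * q + u * q^`() = p^`() * v + p * v^`().
  by rewrite -!derivM e.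
apply/eqP; rewrite eqr_div ?expf_neq0 ?pfrac_eq0 // -!rmorphXn -!rmorphM.
apply/eqP; congr pfrac.
transitivity ((u^`() * q + u * q^`()) * q * v - (u * q) * (q^`() * v + v^`() * q)).
  by ring.
by rewrite e' e; ring.
Qed.

Lemma rf_refl_poly p : rf_refl (pfrac p) = poly_at_zinv p.
Proof. by rewrite -[pfrac p]divr1 -(rmorph1 pfrac) rf_reflE ?oner_neq0 // rmorph1 divr1. Qed.

Definition is_laurent : {pred ratfun F} :=
  fun f => `[< exists p n, f = pfrac p / rf_z ^+ n >].

Lemma is_laurentP f :
  reflect (exists p n, f = pfrac p / rf_z ^+ n) (f \in is_laurent).
Proof. exact: asboolP. Qed.

Lemma is_laurent_poly p : pfrac p \in is_laurent.
Proof. by apply/is_laurentP; exists p, 0; rewrite expr0 divr1. Qed.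

Lemma is_laurent_subring : subring_closed is_laurent.
Proof.
split=> [|f g /is_laurentP[p [m ->]] /is_laurentP[q [n ->]]|
          f g /is_laurentP[p [m ->]] /is_laurentP[q [n ->]]].
- by rewrite -(rmorph1 pfrac) is_laurent_poly.
- apply/is_laurentP; exists (p * 'X^n - q * 'X^m), (m + n)%N.
  by rewrite rmorphB !rmorphM !rmorphXn exprD subf_div ?expf_neq0 ?rf_z_neq0.
- apply/is_laurentP; exists (p * q), (m + n)%N.
  by rewrite rmorphM exprD mulf_div.
Qed.

HB.instance Definition _ :=
  GRing.isSubringClosed.Build (ratfun F) is_laurent is_laurent_subring.

Lemma is_laurent_z (k : int) : rf_z ^ k \in is_laurent.
Proof.
case: k => n; apply/is_laurentP.
  by exists 'X^n, 0; rewrite expr0 divr1 rmorphXn.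
by exists 1, n.+1; rewrite rmorph1 mul1r.
Qed.

Lemma is_laurent_refl f : f \in is_laurent -> rf_refl f \in is_laurent.
Proof.
move=> /is_laurentP[p [n ->]].
rewrite -(rmorphXn pfrac) rf_reflE ?expf_neq0 ?polyX_eq0 //.
rewrite (poly_at_zinvE (leqnSn _)) poly_at_zinvXn.
rewrite invrK rpredM ?(is_laurent_z n%:Z) //.
by apply/is_laurentP; eexists; eexists.
Qed.

Lemma is_laurent_deriv f : f \in is_laurent -> rf_deriv f \in is_laurent.
Proof.
move=> /is_laurentP[p [n ->]].
rewrite -(rmorphXn pfrac) rf_derivE ?expf_neq0 ?polyX_eq0 //.
by rewrite rmorphXn -exprM; apply/is_laurentP; eexists; eexists.
Qed.

Lemma one_sub_z2_neq0 : 1 - rf_z ^+ 2 != 0.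
Proof.
rewrite -rmorphXn -(rmorph1 pfrac) -rmorphB pfrac_eq0 -opprB oppr_eq0.
by rewrite -size_poly_eq0 size_XnsubC.
Qed.

Lemma is_laurent_divdiff_mon c i n :
  (rf_const c * (rf_z ^+ i)^-1 * rf_z ^+ n - rf_const c * rf_z ^+ i / rf_z ^+ n)
    / (1 - rf_z ^+ 2) \in is_laurent.
Proof.
have zn k : rf_z ^+ k != 0 by rewrite expf_neq0 ?rf_z_neq0.
have lc : rf_const c \in is_laurent := is_laurent_poly _.
have h m : (rf_z ^+ m - (rf_z ^+ m)^-1) / (1 - rf_z ^+ 2) \in is_laurent.
  rewrite (divdiff_geom m rf_z_neq0 one_sub_z2_neq0) rpredM ?rpredN ?rpred_sum //.
    by move=> j _; rewrite -exprM (is_laurent_z (2 * j)%N%:Z).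
  by apply/is_laurentP; exists 1, m; rewrite rmorph1 mul1r.
have [/subnK|/ltnW/subnK] := leqP i n.
  move: (n - i)%N => k <-; rewrite exprD.
  by rewrite (divdiff_le _ one_sub_z2_neq0 (zn k) (zn i)) rpredM.
move: (i - n)%N => k <-; rewrite exprD.
by rewrite (divdiff_ge _ one_sub_z2_neq0 (zn k) (zn n)) rpredM // rpredN.
Qed.

Lemma is_laurent_divdiff f : f \in is_laurent ->
  (rf_refl f - f) / (1 - rf_z ^+ 2) \in is_laurent.
Proof.
move=> /is_laurentP[p [n ->]].
rewrite -(rmorphXn pfrac) rf_reflE ?expf_neq0 ?polyX_eq0 // poly_at_zinvXn.
rewrite (rmorphXn pfrac) invrK -/rf_z.
have -> : pfrac p = \sum_(i < size p) rf_const p`_i * rf_z ^+ i.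
  rewrite -{1}[p]coefK poly_def rmorph_sum; apply: eq_bigr => i _.
  by rewrite -mul_polyC rmorphM rmorphXn.
rewrite /poly_at_zinv (horner_coef_wide _ (n := size p)) ?size_map_poly //.
rewrite !mulr_suml -sumrB mulr_suml rpred_sum // => i _.
by rewrite coef_map exprVn is_laurent_divdiff_mon.
Qed.

Lemma is_laurent_K alpha beta f :
  f \in is_laurent -> rf_K alpha beta f \in is_laurent.
Proof.
move=> lf; have lz : rf_z \in is_laurent := is_laurent_poly _.
have lc c : rf_const c \in is_laurent := is_laurent_poly _.
apply: rpredD; first exact: rpredM lz (is_laurent_deriv lf).
rewrite -mulrA [_^-1 * _]mulrC.
by rewrite rpredM ?is_laurent_divdiff // rpredM // rpredD // rpredM.
Qed.

End RationalFunctions.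

Record laurent (F : fieldType) :=
  Laurent { ratfun_of : ratfun F; _ : ratfun_of \in @is_laurent F }.

Section Laurent.
Variable F : fieldType.

HB.instance Definition _ := [isSub for @ratfun_of F].
HB.instance Definition _ := [Choice of laurent F by <:].
HB.instance Definition _ := [SubChoice_isSubComNzRing of laurent F by <:].

Definition lpoly (p : {poly F}) : laurent F := Laurent (is_laurent_poly p).

Fact lpoly_is_zmod_morphism : zmod_morphism lpoly.
Proof. by move=> p q; apply: val_inj; rewrite /= rmorphB. Qed.
Fact lpoly_is_monoid_morphism : monoid_morphism lpoly.
Proof. by split=> [|p q]; apply: val_inj; rewrite /= ?rmorph1 ?rmorphM. Qed.
HB.instance Definition _ := GRing.isZmodMorphism.Build _ _ lpoly
  lpoly_is_zmod_morphism.
HB.instance Definition _ := GRing.isMonoidMorphism.Build _ _ lpoly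
  lpoly_is_monoid_morphism.

Definition lscale (c : F) (f : laurent F) : laurent F := lpoly c%:P * f.

Fact lscaleA a b v : lscale a (lscale b v) = lscale (a * b) v.
Proof. by rewrite /lscale mulrA -rmorphM -polyCM. Qed.
Fact lscale1 : left_id 1 lscale.
Proof. by move=> v; rewrite /lscale rmorph1 mul1r. Qed.
Fact lscaleDr : right_distributive lscale +%R.
Proof. by move=> c u v; rewrite /lscale mulrDr. Qed.
Fact lscaleDl v : {morph lscale^~ v : a b / a + b}.
Proof. by move=> a b; rewrite /lscale polyCD rmorphD mulrDl. Qed.
HB.instance Definition _ := GRing.Zmodule_isLmodule.Build F (laurent F)
  lscaleA lscale1 lscaleDr lscaleDl.

Definition zpow (k : int) : laurent F := Laurent (is_laurent_z F k).

Definition lrefl (f : laurent F) : laurent F :=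
  Laurent (is_laurent_refl (valP f)).

Definition calK (alpha beta : F) (f : laurent F) : laurent F :=
  Laurent (is_laurent_K alpha beta (valP f)).

(* z ^ n p(1/z), for p of degree at most n (see recipE) *)
Definition recip (n : nat) (p : {poly F}) : {poly F} :=
  \poly_(i < n.+1) p`_(n - i).

Lemma recipE n (p : {poly F}) : (size p <= n.+1)%N ->
  lpoly (recip n p) = zpow n * lrefl (lpoly p).
Proof.
move=> sp; apply: val_inj => /=.
rewrite rf_refl_poly (poly_at_zinvE sp) mulrC -exprnP divfK //.
by rewrite expf_neq0 ?rf_z_neq0.
Qed.

Fixpoint Phi (a : nat -> F) (n : nat) : {poly F} :=
  if n is m.+1 then 'X * Phi a m - a m *: recip m (Phi a m) else 1.

Lemma Phi_monic_size a n : Phi a n \is monic /\ size (Phi a n) = n.+1.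
Proof.
elim: n => [|n [IHm IHs]]; first by rewrite monic1 size_poly1.
have sX : size ('X * Phi a n) = n.+2.
  by rewrite mulrC size_mulX ?IHs // -size_poly_eq0 IHs.
have lt : (size (- (a n *: recip n (Phi a n))) < size ('X * Phi a n)%R)%N.
  rewrite size_polyN sX ltnS (leq_trans (size_scale_leq _ _)) //.
  exact: size_poly.
split; last by rewrite /= size_polyDl.
by rewrite monicE /= lead_coefDl // lead_coefM lead_coefX mul1r -monicE.
Qed.

Definition psi (a : nat -> F) (n : nat) : laurent F :=
  let m := n./2 in
  if odd n then zpow (- m%:Z) * lpoly (Phi a n)
  else zpow m * lrefl (lpoly (Phi a n)).

Definition jacobi_verblunsky (alpha beta : F) (n : nat) : F :=
  - ((alpha + 2^-1 + (-1) ^+ n.+1 * (beta + 2^-1))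
     / (n%:R + alpha + beta + 2)).

Definition jacobi_eigenvalue (alpha beta : F) (n : nat) : F :=
  if odd n then n.+1%:R / 2 + alpha + beta + 1 else - (n%:R / 2).

End Laurent.

(* Main.v *)
Require Import Defs.
From mathcomp Require Import all_boot all_order all_algebra.
From HB Require Import structures.
From mathcomp Require Import ring.
Set Implicit Arguments.
Unset Strict Implicit.
Unset Printing Implicit Defensive.
Import Order.TTheory GRing.Theory Num.Theory.
Local Open Scope ring_scope.

(** Let [S = z R].  Both [R] and [S] are involutions, and a direct computation
gives, with [c = alpha + beta + 1] and [d = alpha - beta],
  [K R + R K = c R - c]   and   [K S + S K = (c + 1) S + d].
In terms of the CMV Laurent polynomials the Szegő recurrence reads
  [psi_(n+1) = S psi_n - a_n psi_n] for even [n],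
  [psi_(n+1) = R psi_n - a_n psi_n] for odd [n].
So if [K psi_n = l psi_n], then [psi_(n+1)] is an eigenvector of [K], with
eigenvalue [c + 1 - l], resp. [c - l], as soon as [a_n] satisfies
[a_n (c + 1 - 2 l) = - d], resp. [a_n (c - 2 l) = c]; these are the Jacobi
Verblunsky parameters. *)

(** * Fraction identities behind the quotient rule and the Szegő recurrence *)

Section FieldIdentities.
Variable K : fieldType.
Implicit Types p q u v : K.

(** The primed letters are free variables that stand for the derivatives of [p], [q], [u], [v]: this
    is the quotient rule for [p / q - u / v]. *)
Lemma quot_derivB p q u v p' q' u' v' : q != 0 -> v != 0 ->
  ((p' * v + p * v' - (u' * q + u * q')) * (q * v)
     - (p * v - u * q) * (q' * v + q * v')) / (q * v) ^+ 2
  = (p' * q - p * q') / q ^+ 2 - (u' * v - u * v') / v ^+ 2.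
Proof. by move=> q0 v0; field; rewrite q0 v0. Qed.

Lemma quot_derivM p q u v p' q' u' v' : q != 0 -> v != 0 ->
  ((p' * u + p * u') * (q * v) - p * u * (q' * v + q * v')) / (q * v) ^+ 2
  = (p' * q - p * q') / q ^+ 2 * (u / v) + p / q * ((u' * v - u * v') / v ^+ 2).
Proof. by move=> q0 v0; field; rewrite q0 v0. Qed.

(** To be used with [y] = [z ^+ m], [p] a polynomial [Phi a n] and [q] its image under z -> 1/z. *)
Lemma szego_even y z p q a : y != 0 ->
  y^-1 * (z * p - a * (y * y * q)) = z * (y^-1 * p) - a * (y * q).
Proof. by move=> y0; field. Qed.

Lemma szego_odd y z p q a : y != 0 -> z != 0 ->
  z * y * (z^-1 * q - a * ((z * (y * y))^-1 * p)) = y * q - a * (y^-1 * p).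
Proof. by move=> y0 z0; field; rewrite y0 z0. Qed.

End FieldIdentities.

(** * The operator K over a field with a reflection and a derivation *)

Section ReflectionDerivation.
Variables (K : fieldType) (R : {rmorphism K -> K}) (D : {additive K -> K}).
Variable z : K.
Hypothesis derM : forall f g, D (f * g) = D f * g + f * D g.
Implicit Types a f g l : K.

Lemma derV f : f != 0 -> D f^-1 = - (D f / f ^+ 2).
Proof.
have d1 : D 1 = 0.
  by apply: (addrI (D 1)); rewrite addr0 -{3}[1]mulr1 derM mulr1 mul1r.
move=> f0; apply: (mulfI f0); apply: (addrI (D f / f)).
by rewrite -derM divff // d1; field.
Qed.

(** The chain rule for f(1/z), as a predicate on [f] that propagates through the field
    operations. *)
Definition chain_refl f := D (R f) = - (R (D f) / z ^+ 2).

Lemma chain_reflD f g : chain_refl f -> chain_refl g -> chain_refl (f + g).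
Proof. by rewrite /chain_refl !raddfD => -> -> /=; rewrite mulrDl opprD. Qed.

Lemma chain_reflM f g : chain_refl f -> chain_refl g -> chain_refl (f * g).
Proof.
rewrite /chain_refl rmorphM !derM => -> ->.
by rewrite rmorphD !rmorphM /=; ring.
Qed.

Lemma chain_reflV f : chain_refl f -> chain_refl f^-1.
Proof.
have [->|f0] := eqVneq f 0; first by rewrite invr0.
have rf0 : R f != 0 by rewrite fmorph_eq0.
rewrite /chain_refl fmorphV !derV // => ->.
by rewrite rmorphN fmorph_div rmorphXn /=; ring.
Qed.

Variables c d : K.
Hypotheses (z0 : z != 0) (z1 : 1 - z ^+ 2 != 0).
Hypotheses (Rz : R z = z^-1) (Rc : R c = c) (Rd : R d = d).
Hypotheses (Dz : D z = 1) (RK : involutive R) (DR : forall f, chain_refl f).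

Definition dunkl f := z * D f + z * (c * z + d) / (1 - z ^+ 2) * (R f - f).

(** [R] sends 1 - z^2 to (z^2 - 1) / z^2, so clearing denominators also meets this factor. *)
Let z1' : z ^+ 2 - 1 != 0.
Proof. by rewrite -opprB oppr_eq0. Qed.

Lemma dunklB f g : dunkl (f - g) = dunkl f - dunkl g.
Proof. by rewrite /dunkl !raddfB /=; ring. Qed.

Lemma dunklZ a f : R a = a -> D a = 0 -> dunkl (a * f) = a * dunkl f.
Proof. by move=> ra da; rewrite /dunkl derM da rmorphM ra; ring. Qed.

(** By the chain rule z D(R f) = - R(z D f), so the derivative terms cancel in KR + RK. With w =
    z(cz + d)/(1 - z^2), what remains is (w + R w)(f - R f), and w + R w = - c. *)
Lemma dunkl_refl f : dunkl (R f) = c * R f - c * f - R (dunkl f).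
Proof.
rewrite /dunkl DR RK !(rmorphD, rmorphN, rmorphM, fmorphV, rmorphXn, rmorph1).
by rewrite /= !RK Rz Rc Rd; field; rewrite z0 z1 z1'.
Qed.

(** The derivatives of [f] cancel again, and [D z = 1] contributes the extra z R f. With w as
    before, the coefficient of [f] is w/z + z R w = d. *)
Lemma dunkl_zrefl f :
  dunkl (z * R f) = (c + 1) * (z * R f) + d * f - z * R (dunkl f).
Proof.
rewrite /dunkl derM Dz DR !(rmorphD, rmorphN, rmorphM, fmorphV, rmorphXn).
by rewrite rmorph1 /= !RK Rz Rc Rd; field; rewrite z0 z1 z1'.
Qed.

(** The left side is (c - l) R f - (c + a l) f, and the condition on [a] says exactly that c + a l =
    a (c - l). *)
Lemma dunkl_refl_eigen a l f : R a = a -> D a = 0 -> R l = l ->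
    a * (c - l *+ 2) = c -> dunkl f = l * f ->
  dunkl (R f - a * f) = (c - l) * (R f - a * f).
Proof.
move=> ra da rl e kf; rewrite dunklB (dunklZ f ra da) dunkl_refl kf rmorphM rl /=.
by rewrite -[X in _ - X * f]e; ring.
Qed.

Lemma dunkl_zrefl_eigen a l f : R a = a -> D a = 0 -> R l = l ->
    a * (c + 1 - l *+ 2) = - d -> dunkl f = l * f ->
  dunkl (z * R f - a * f) = (c + 1 - l) * (z * R f - a * f).
Proof.
move=> ra da rl e kf; rewrite dunklB (dunklZ f ra da) dunkl_zrefl kf rmorphM rl /=.
by rewrite -[d]opprK -e; ring.
Qed.

End ReflectionDerivation.

(** * Reflection and derivation on rational functions *)

Section RationalFunctions.
Variable F : fieldType.
Implicit Types (p q : {poly F}) (f g : ratfun F) (c : F).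

Lemma ratfun_ind (P : ratfun F -> Prop) :
  (forall p q, q != 0 -> P (pfrac p / pfrac q)) -> forall f, P f.
Proof. by move=> h f; have [e d0] := rf_repr f; rewrite e; apply: h. Qed.

(** Constants and z generate F(z) as a field; this reduces involutivity of the reflection and the
    chain rule to these generators. *)
Lemma ratfun_field_ind (P : ratfun F -> Prop) :
    (forall c, P (rf_const c)) -> P (rf_z F) ->
    (forall f g, P f -> P g -> P (f + g)) ->
    (forall f g, P f -> P g -> P (f * g)) -> (forall f, P f -> P f^-1) ->
  forall f, P f.
Proof.
move=> hc hz hD hM hV.
have h p : P (pfrac p).
  elim/poly_ind: p => [|p c IH]; first by rewrite -(rmorph0 polyC); apply: hc.
  by rewrite rmorphD rmorphM; apply: hD (hc c); apply: hM.
by elim/ratfun_ind=> p q _; apply: hM => //; apply: hV.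
Qed.

Lemma rf_refl_is_zmod_morphism : zmod_morphism (@rf_refl F).
Proof.
move=> f g; elim/ratfun_ind: f => p q q0; elim/ratfun_ind: g => u v v0.
rewrite subf_div ?pfrac_eq0 // -!rmorphM -rmorphB !rf_reflE ?mulf_neq0 //.
by rewrite rmorphB !rmorphM subf_div ?poly_at_zinv_eq0.
Qed.

Lemma rf_refl_is_monoid_morphism : monoid_morphism (@rf_refl F).
Proof.
split; first by rewrite -(rmorph1 (@pfrac F)) rf_refl_poly !rmorph1.
move=> f g; elim/ratfun_ind: f => p q q0; elim/ratfun_ind: g => u v v0.
rewrite mulf_div -!rmorphM !rf_reflE ?mulf_neq0 //.
by rewrite !rmorphM mulf_div.
Qed.

HB.instance Definition _ := GRing.isZmodMorphism.Build _ _ (@rf_refl F)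
  rf_refl_is_zmod_morphism.
HB.instance Definition _ := GRing.isMonoidMorphism.Build _ _ (@rf_refl F)
  rf_refl_is_monoid_morphism.

Lemma rf_reflD : {morph @rf_refl F : f g / f + g}.
Proof. exact: rmorphD. Qed.

Lemma rf_reflB : {morph @rf_refl F : f g / f - g}.
Proof. exact: rmorphB. Qed.

Lemma rf_reflM : {morph @rf_refl F : f g / f * g}.
Proof. exact: rmorphM. Qed.

Lemma rf_reflV : {morph @rf_refl F : f / f^-1}.
Proof. exact: fmorphV. Qed.

Lemma rf_refl_const c : rf_refl (rf_const c) = rf_const c.
Proof. by rewrite rf_refl_poly /poly_at_zinv map_polyC hornerC. Qed.

Lemma rf_refl_z : rf_refl (rf_z F) = (rf_z F)^-1.
Proof. by rewrite rf_refl_poly -['X]expr1 poly_at_zinvXn. Qed.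

Lemma rf_reflK : involutive (@rf_refl F).
Proof.
elim/ratfun_field_ind=> [c||f g ef eg|f g ef eg|f ef].
- by rewrite !rf_refl_const.
- by rewrite rf_refl_z rf_reflV rf_refl_z invrK.
- by rewrite (rf_reflD f) (rf_reflD (rf_refl f)) ef eg.
- by rewrite (rf_reflM f) (rf_reflM (rf_refl f)) ef eg.
- by rewrite (rf_reflV f) (rf_reflV (rf_refl f)) ef.
Qed.

Lemma rf_deriv_poly p : rf_deriv (pfrac p) = pfrac p^`().
Proof.
rewrite -[pfrac p]divr1 -(rmorph1 (@pfrac F)) rf_derivE ?oner_neq0 //.
by rewrite derivC mulr0 subr0 mulr1 rmorph1 expr1n divr1.
Qed.

Lemma rf_deriv_is_zmod_morphism : zmod_morphism (@rf_deriv F).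
Proof.
move=> f g; elim/ratfun_ind: f => p q q0; elim/ratfun_ind: g => u v v0.
rewrite subf_div ?pfrac_eq0 // -!rmorphM -rmorphB !rf_derivE ?mulf_neq0 //.
rewrite derivB !derivM !(rmorphB, rmorphM, rmorphD).
by rewrite quot_derivB ?pfrac_eq0.
Qed.

HB.instance Definition _ := GRing.isZmodMorphism.Build _ _ (@rf_deriv F)
  rf_deriv_is_zmod_morphism.

Lemma rf_derivM f g : rf_deriv (f * g) = rf_deriv f * g + f * rf_deriv g.
Proof.
elim/ratfun_ind: f => p q q0; elim/ratfun_ind: g => u v v0.
rewrite mulf_div -!rmorphM !rf_derivE ?mulf_neq0 //.
rewrite !derivM !(rmorphB, rmorphM, rmorphD).
by rewrite quot_derivM ?pfrac_eq0.
Qed.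

Lemma rf_deriv_const c : rf_deriv (rf_const c) = 0.
Proof. by rewrite rf_deriv_poly derivC rmorph0. Qed.

Lemma rf_deriv_z : rf_deriv (rf_z F) = 1.
Proof. by rewrite rf_deriv_poly derivX rmorph1. Qed.

Lemma rf_deriv_refl f :
  chain_refl (@rf_refl F) (@rf_deriv F) (rf_z F) f.
Proof.
elim/ratfun_field_ind: f => [c||f g|f g|f].
- rewrite /chain_refl /= rf_refl_const rf_deriv_const.
  by rewrite (rmorph0 (@rf_refl F)) mul0r oppr0.
- rewrite /chain_refl /= rf_refl_z (derV rf_derivM) ?rf_z_neq0 //=.
  by rewrite rf_deriv_z (rmorph1 (@rf_refl F)).
- exact: (chain_reflD (D := @rf_deriv F)).
- exact: (chain_reflM rf_derivM).
- exact: (chain_reflV rf_derivM).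
Qed.

Lemma rf_K_refl_eigen (alpha beta a l : F) f :
    a * (alpha + beta + 1 - l *+ 2) = alpha + beta + 1 ->
    rf_K alpha beta f = rf_const l * f ->
  rf_K alpha beta (rf_refl f - rf_const a * f)
  = rf_const (alpha + beta + 1 - l) * (rf_refl f - rf_const a * f).
Proof.
move=> e kf; rewrite (rmorphB (@rf_const F)).
apply: (dunkl_refl_eigen (rf_derivM) (rf_z_neq0 F) (one_sub_z2_neq0 F)
  rf_refl_z (rf_refl_const _) (rf_refl_const _) rf_reflK rf_deriv_refl
  (rf_refl_const a) (rf_deriv_const a) (rf_refl_const l) _ kf).
by rewrite -(rmorphMn (@rf_const F)) -(rmorphB (@rf_const F))
  -(rmorphM (@rf_const F)) e.
Qed.

Lemma rf_K_zrefl_eigen (alpha beta a l : F) f :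
    a * (alpha + beta + 1 + 1 - l *+ 2) = - (alpha - beta) ->
    rf_K alpha beta f = rf_const l * f ->
  rf_K alpha beta (rf_z F * rf_refl f - rf_const a * f)
  = rf_const (alpha + beta + 1 + 1 - l)
    * (rf_z F * rf_refl f - rf_const a * f).
Proof.
have c1 (b : F) : rf_const (b + 1) = rf_const b + 1.
  by rewrite (rmorphD (@rf_const F)) (rmorph1 (@rf_const F)).
(* [dunkl_zrefl_eigen] has the 1 of c + 1 outside the constant c, hence the splitting by [c1]. *)
move=> e kf; rewrite (rmorphB (@rf_const F)) [_ (_ + 1)]c1.
apply: (dunkl_zrefl_eigen (rf_derivM) (rf_z_neq0 F) (one_sub_z2_neq0 F)
  rf_refl_z (rf_refl_const _) (rf_refl_const _) rf_deriv_z rf_reflK rf_deriv_refl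
  (rf_refl_const a) (rf_deriv_const a) (rf_refl_const l) _ kf).
by rewrite -c1 -(rmorphMn (@rf_const F)) -(rmorphB (@rf_const F))
  -(rmorphM (@rf_const F)) e (rmorphN (@rf_const F)).
Qed.

(** * Szegő recurrence for the CMV Laurent polynomials *)

Lemma pfrac_Phi_rec (a : nat -> F) n :
  pfrac (Phi a n.+1) = rf_z F * pfrac (Phi a n)
    - rf_const (a n) * (rf_z F ^+ n * rf_refl (pfrac (Phi a n))).
Proof.
rewrite /= (rmorphB (@pfrac F)) (rmorphM (@pfrac F)) -mul_polyC.
(* Since [Phi a n] has size [n.+1], its [recip n] is z^n times its reflection. *)
rewrite (rmorphM (@pfrac F)) rf_refl_poly (@poly_at_zinvE _ _ n); last first.
  by case: (Phi_monic_size a n) => _ ->.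
by rewrite [_ ^+ n * _]mulrC divfK // expf_neq0 ?rf_z_neq0.
Qed.

Lemma psi_double (a : nat -> F) m :
  ratfun_of (psi a m.*2) = rf_z F ^+ m * rf_refl (pfrac (Phi a m.*2)).
Proof. by rewrite /psi odd_double doubleK. Qed.

Lemma psi_doubleS (a : nat -> F) m :
  ratfun_of (psi a m.*2.+1) = (rf_z F ^+ m)^-1 * pfrac (Phi a m.*2.+1).
Proof.
by rewrite /psi [odd _]/= odd_double [_./2]/= uphalf_double [LHS]/= -invr_expz.
Qed.

Lemma psi_rec_even (a : nat -> F) m :
  ratfun_of (psi a m.*2.+1)
  = rf_z F * rf_refl (ratfun_of (psi a m.*2))
    - rf_const (a m.*2) * ratfun_of (psi a m.*2).
Proof.
have y0 : rf_z F ^+ m != 0 by rewrite expf_neq0 ?rf_z_neq0.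
rewrite psi_doubleS psi_double pfrac_Phi_rec -addnn exprD.
by rewrite szego_even // rf_reflM (rmorphXn (@rf_refl F)) /= rf_refl_z rf_reflK exprVn.
Qed.

(** Obtained by reflecting the Szegő recurrence at n = 2m + 1 and multiplying by z^(m+1). *)
Lemma psi_rec_odd (a : nat -> F) m :
  ratfun_of (psi a m.+1.*2)
  = rf_refl (ratfun_of (psi a m.*2.+1))
    - rf_const (a m.*2.+1) * ratfun_of (psi a m.*2.+1).
Proof.
have z0 := rf_z_neq0 F; have y0 : rf_z F ^+ m != 0 by rewrite expf_neq0.
rewrite psi_double psi_doubleS doubleS pfrac_Phi_rec.
rewrite rf_reflB (rf_reflM (rf_z F)) (rf_reflM (rf_const _)).
rewrite (rf_reflM (rf_z F ^+ _)) rf_refl_const (rf_reflM (rf_z F ^- _)).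
have rX k : rf_refl (rf_z F ^+ k) = (rf_z F ^+ k)^-1.
  by rewrite (rmorphXn (@rf_refl F)) /= rf_refl_z exprVn.
rewrite rf_reflV !rX rf_refl_z rf_reflK invrK !exprS -addnn exprD.
exact: (szego_odd _ _ _ y0 z0).
Qed.

End RationalFunctions.

(** * Jacobi parameters and the induction on n *)

Section Jacobi.
Variables (R : realFieldType) (alpha beta : R).
Hypothesis hden : forall n : nat, n%:R + alpha + beta + 2 != 0.
Let a := jacobi_verblunsky alpha beta.
Let l := jacobi_eigenvalue alpha beta.

Lemma jacobi_eigenvalue_rec n :
  l n.+1 = (if odd n then alpha + beta + 1 else alpha + beta + 1 + 1) - l n.
Proof.
by rewrite /l /jacobi_eigenvalue /=; case: (odd n); rewrite /= -?natr1; field.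
Qed.

(** For even n the second factor is n + alpha + beta + 2, the denominator of [a n]. *)
Lemma jacobi_verblunsky_even n : ~~ odd n ->
  a n * (alpha + beta + 1 + 1 - l n *+ 2) = - (alpha - beta).
Proof.
move=> en; rewrite /a /l /jacobi_verblunsky /jacobi_eigenvalue (negbTE en).
by rewrite -signr_odd /= en expr1; have h := hden n; field.
Qed.

(** For odd n the second factor is minus the denominator of [a n], whose sign it cancels. *)
Lemma jacobi_verblunsky_odd n : odd n ->
  a n * (alpha + beta + 1 - l n *+ 2) = alpha + beta + 1.
Proof.
move=> on; rewrite /a /l /jacobi_verblunsky /jacobi_eigenvalue on.
by rewrite -signr_odd /= on expr0 -natr1; have h := hden n; field.
Qed.

Lemma rf_K_psi n :
  rf_K alpha beta (ratfun_of (psi a n))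
  = rf_const (l n) * ratfun_of (psi a n).
Proof.
elim: n => [|n IH].
  have -> : ratfun_of (psi a 0) = 1.
    by rewrite -[0%N]double0 psi_double mul1r (rmorph1 (@pfrac R)) rmorph1.
  (* K annihilates the constant 1, in accordance with [l 0] = 0. *)
  rewrite /rf_K (rmorph1 (@rf_refl R)) subrr mulr0 addr0.
  rewrite -(rmorph1 (@rf_const R)) rf_deriv_const mulr0.
  by rewrite /l /jacobi_eigenvalue /= mul0r oppr0 (rmorph0 (@rf_const R)) mul0r.
rewrite jacobi_eigenvalue_rec; have [on|en] := boolP (odd n).
  have e := jacobi_verblunsky_odd on.
  (* Writing n as 2m + 1 gives the shape required by [psi_rec_odd]. *)
  move: IH e; rewrite -[n]odd_double_half on add1n => IH e.
  by rewrite -doubleS psi_rec_odd (rf_K_refl_eigen e IH).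
have e := jacobi_verblunsky_even en.
move: IH e; rewrite -[n]odd_double_half (negbTE en) add0n => IH e.
by rewrite psi_rec_even (rf_K_zrefl_eigen e IH).
Qed.

End Jacobi.

Theorem proposition1 (R : realFieldType) (alpha beta : R)
    (hden : forall n : nat, n%:R + alpha + beta + 2 != 0)
    (ha : forall n : nat, -1 < jacobi_verblunsky alpha beta n < 1)
    (n : nat) :
  calK alpha beta (psi (jacobi_verblunsky alpha beta) n)
  = jacobi_eigenvalue alpha beta n *: psi (jacobi_verblunsky alpha beta) n.
(* Equality in [laurent] is tested in F(z), where scaling is multiplication by [rf_const]. *)
Proof. by apply: val_inj; exact: rf_K_psi. Qed.
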